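(* The class of all lattices that can be embedded into some lattice of the form $\mathbf{Co}(P)$, with $P$ a poset, coincides with $\mathbf{SUB}$; it is a finitely based variety. In particular, it is closed under homomorphic images.
   Context: For a poset $\langle P,\trianglelefteq\rangle$, a subset $X\subseteq P$ is order-convex if $x\trianglelefteq z\trianglelefteq y$ and $x,y\in X$ imply $z\in X$, for all $x,y,z\in P$. $\mathbf{Co}(P)$ denotes the lattice of all order-convex subsets of $P$, ordered by inclusion. A variety is finitely based if it is defined by finitely many identities. $\mathbf{SUB}$ denotes the class of all lattices that satisfy the three identities (S), (U), (B) below. (S), in the variables $a,b,b_0,b_1,c$: $$a\wedge(b'\vee c)=(a\wedge b')\vee\bigvee_{i<2}\Bigl(a\wedge(b_i\vee c)\wedge\bigl((b'\wedge(a\vee b_i))\vee c\bigr)\Bigr),\quad\text{where } b'=b\wedge(b_0\vee b_1).$$ (U), in the variables $x,x_0,x_1,x_2$: $$x\wedge(x_0\vee x_1)\wedge(x_1\vee x_2)\wedge(x_0\vee x_2)=(x\wedge x_0\wedge(x_1\vee x_2))\vee(x\wedge x_1\wedge(x_0\vee x_2))\vee(x\wedge x_2\wedge(x_0\vee x_1)).$$ (B), in the variables $x,a_0,a_1,b_0,b_1$: $$x\wedge(a_0\vee a_1)\wedge(b_0\vee b_1)=\bigvee_{i<2}\Bigl(\bigl(x\wedge a_i\wedge(b_0\vee b_1)\bigr)\vee\bigl(x\wedge b_i\wedge(a_0\vee a_1)\bigr)\Bigr)\vee\bigvee_{i<2}\bigl(x\wedge(a_0\vee a_1)\wedge(b_0\vee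 b_1)\wedge(a_0\vee b_i)\wedge(a_1\vee b_{1-i})\bigr).$$ *)

(* Defs.v *)
From HB Require Import structures.
From mathcomp Require Import all_boot all_order.
From mathcomp Require Import boolp classical_sets cardinality.

Set Implicit Arguments.
Unset Strict Implicit.
Unset Printing Implicit Defensive.

Import Order.TTheory.
Local Open Scope order_scope.

(* All lattices and posets are MathComp [latticeType]s and [porderType]s.
   Under the classical axioms of [boolp] every type is a choiceType and every
   relation is boolean, so this is no restriction on lattices or posets. *)

Section Co.
Context {d : Order.disp_t} (P : porderType d).
Implicit Types X Y : set P.

Definition order_convex X : Prop :=
  forall x y z : P, X x -> X y -> x <= z -> z <= y -> X z.

Record Co : Type := MkCo {
  co_set :> set P;
  co_setP : `[< order_convex co_set >] }.

HB.instance Definition _ := [isSub for co_set].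
HB.instance Definition _ := [Choice of Co by <:].
(* The order of [set P] is inclusion. *)
HB.instance Definition _ := [SubChoice_isSubPOrder of Co by <: with set_display].

Lemma le_CoE (X Y : Co) : (X <= Y) = `[< (X `<=` Y)%classic >].
Proof. by []. Qed.

Lemma co_convex (X : Co) : order_convex X.
Proof. exact/asboolP/co_setP. Qed.

Definition convex_hull X : set P :=
  [set z | exists x y, [/\ X x, X y, x <= z & z <= y]]%classic.

Lemma setI_convex (X Y : Co) : `[< order_convex (X `&` Y)%classic >].
Proof.
apply/asboolP => x y z [Xx Yx] [Xy Yy] xz zy.
by split; [apply: (co_convex Xx Xy) | apply: (co_convex Yx Yy)].
Qed.

Lemma convex_hull_convex X : `[< order_convex (convex_hull X) >].
Proof.
apply/asboolP => x y z [x1 [x2 [X1 X2 le1 le2]]] [y1 [y2 [Y1 Y2 le3 le4]]] xz zy.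
exists x1, y2; split=> //; first exact: le_trans xz.
exact: le_trans zy le4.
Qed.

Definition co_meet (X Y : Co) : Co := MkCo (setI_convex X Y).
Definition co_join (X Y : Co) : Co :=
  MkCo (convex_hull_convex (X `|` Y)%classic).

Lemma co_meetP (X Y Z : Co) : (X <= co_meet Y Z) = (X <= Y) && (X <= Z).
Proof.
rewrite !le_CoE; apply/asboolP/andP => [XYZ|[/asboolP XY /asboolP XZ] x Xx].
  by split; apply/asboolP => x /XYZ[].
by split; [apply: XY | apply: XZ].
Qed.

Lemma co_joinP (X Y Z : Co) : (co_join X Y <= Z) = (X <= Z) && (Y <= Z).
Proof.
rewrite !le_CoE; apply/asboolP/andP => [XYZ|[/asboolP XZ /asboolP YZ] z].
  by split; apply/asboolP => x ?; apply: XYZ; exists x, x;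
    split=> //; [left | left | right | right].
move=> [x [y [XYx XYy xz zy]]].
have XYZ : ((X `|` Y) `<=` Z)%classic by move=> t [/XZ|/YZ].
exact: (co_convex (XYZ _ XYx) (XYZ _ XYy)).
Qed.

HB.instance Definition _ :=
  Order.POrder_MeetJoin_isLattice.Build set_display Co co_meetP co_joinP.

End Co.

Definition lattice_class := forall d : Order.disp_t, latticeType d -> Prop.

Definition Co_embeddable : lattice_class := fun d L =>
  exists (d' : Order.disp_t) (P : porderType d') (f : {lmorphism L -> Co P}),
    injective f.

Section Identities.
Context {d : Order.disp_t} (L : latticeType d).

Definition identity_S : Prop := forall a b b0 b1 c : L,
  let b' := b `&` (b0 `|` b1) in
  let t bi := a `&` (bi `|` c) `&` ((b' `&` (a `|` bi)) `|` c) in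
  a `&` (b' `|` c) = (a `&` b') `|` (t b0 `|` t b1).

Definition identity_U : Prop := forall x x0 x1 x2 : L,
  x `&` (x0 `|` x1) `&` (x1 `|` x2) `&` (x0 `|` x2) =
  (x `&` x0 `&` (x1 `|` x2)) `|` (x `&` x1 `&` (x0 `|` x2))
    `|` (x `&` x2 `&` (x0 `|` x1)).

Definition identity_B : Prop := forall x a0 a1 b0 b1 : L,
  let s ai bi := (x `&` ai `&` (b0 `|` b1)) `|` (x `&` bi `&` (a0 `|` a1)) in
  let t bi bj :=
    x `&` (a0 `|` a1) `&` (b0 `|` b1) `&` (a0 `|` bi) `&` (a1 `|` bj) in
  x `&` (a0 `|` a1) `&` (b0 `|` b1) =
  (s a0 b0 `|` s a1 b1) `|` (t b0 b1 `|` t b1 b0).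

End Identities.

Definition SUB : lattice_class := fun d L =>
  [/\ identity_S L, identity_U L & identity_B L].

Inductive lterm : Type :=
| LVar of nat
| LMeet of lterm & lterm
| LJoin of lterm & lterm.

Fixpoint leval d (L : latticeType d) (v : nat -> L) (t : lterm) : L :=
  match t with
  | LVar n => v n
  | LMeet t1 t2 => leval v t1 `&` leval v t2
  | LJoin t1 t2 => leval v t1 `|` leval v t2
  end.

Definition lidentity : Type := (lterm * lterm)%type.

Definition satisfies d (L : latticeType d) (e : lidentity) : Prop :=
  forall v : nat -> L, leval v e.1 = leval v e.2.

Definition defined_by (E : set lidentity) (K : lattice_class) : Prop :=
  forall (d : Order.disp_t) (L : latticeType d),
    K d L <-> (forall e, E e -> satisfies L e).

Definition is_variety (K : lattice_class) : Prop :=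
  exists E : set lidentity, defined_by E K.

Definition finitely_based (K : lattice_class) : Prop :=
  exists E : set lidentity, finite_set E /\ defined_by E K.

Definition closed_under_homomorphic_images (K : lattice_class) : Prop :=
  forall (d d' : Order.disp_t) (L : latticeType d) (M : latticeType d')
    (f : {lmorphism L -> M}),
    (forall y : M, exists x : L, f x = y) -> K d L -> K d' M.

(* Main.v *)
(* The identities hold in [Co P] by inspecting, for a point [x], which arguments
   have elements below or above [x].  Conversely, a lattice satisfying (S), (U),
   (B) embeds into its lattice [M] of filters, which satisfies the same
   identities, is separated by join-irreducible elements and has minimal covers.
   For a join-irreducible [p] in [M], (U) and (B) make the nontrivial covers
   [p <= x `|` y] the edges of a complete bipartite graph.  (S) says how the two
   sides at [p] match those at a minimal member [c] of a cover of [p].  Growing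
   from every [p] the tree of its minimal covers, with one side placed below and
   the other above the parent, gives a poset whose nodes are labelled by
   join-irreducibles, and [x] is sent to the set of nodes labelled below [x].
   This set is order-convex since, along a monotone branch of the tree, labels
   stay below the join of the labels at the two ends. *)

Require Import Defs.
From mathcomp Require Import all_boot all_order.
From HB Require Import structures.
From mathcomp Require Import boolp classical_sets cardinality.

Set Implicit Arguments.
Unset Strict Implicit.
Unset Printing Implicit Defensive.

Import Order.TTheory.
Local Open Scope order_scope.

Ltac lattice_le :=
  first [ exact: lexx
        | rewrite leUx; apply/andP; split; lattice_le
        | rewrite lexI; apply/andP; split; lattice_le
        | apply: leIxl; lattice_le | apply: leIxr; lattice_le
        | apply: lexUl; lattice_le | apply: lexUr; lattice_le ].

(** * Lattice terms and the finite equational basis *)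

Section TermPreservation.
Context {d d' : Order.disp_t} {L : latticeType d} {M : latticeType d'}.
Variable f : {lmorphism L -> M}.

Lemma leval_morph (v : nat -> L) t : f (leval v t) = leval (f \o v) t.
Proof.
by elim: t => //= t1 <- t2 <-; [exact: omorphI | exact: omorphU].
Qed.

Lemma satisfies_inj e : injective f -> satisfies M e -> satisfies L e.
Proof. by move=> f_inj Me v; apply: f_inj; rewrite !leval_morph. Qed.

Lemma satisfies_surj e :
  (forall y, exists x, f x = y) -> satisfies L e -> satisfies M e.
Proof.
move=> /choice[g gK] Le v.
have -> : v = f \o (g \o v) by apply/funext => n /=; rewrite gK.
by rewrite -!leval_morph Le.
Qed.

End TermPreservation.

Definition eS : lidentity :=
  let a := LVar 0 in let b := LVar 1 in let b0 := LVar 2 in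
  let b1 := LVar 3 in let c := LVar 4 in
  let b' := LMeet b (LJoin b0 b1) in
  let t bi := LMeet (LMeet a (LJoin bi c)) (LJoin (LMeet b' (LJoin a bi)) c) in
  (LMeet a (LJoin b' c), LJoin (LMeet a b') (LJoin (t b0) (t b1))).

Definition eU : lidentity :=
  let x := LVar 0 in let x0 := LVar 1 in let x1 := LVar 2 in
  let x2 := LVar 3 in
  (LMeet (LMeet (LMeet x (LJoin x0 x1)) (LJoin x1 x2)) (LJoin x0 x2),
   LJoin (LJoin (LMeet (LMeet x x0) (LJoin x1 x2))
                (LMeet (LMeet x x1) (LJoin x0 x2)))
         (LMeet (LMeet x x2) (LJoin x0 x1))).

Definition eB : lidentity :=
  let x := LVar 0 in let a0 := LVar 1 in let a1 := LVar 2 in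
  let b0 := LVar 3 in let b1 := LVar 4 in
  let s ai bi := LJoin (LMeet (LMeet x ai) (LJoin b0 b1))
                       (LMeet (LMeet x bi) (LJoin a0 a1)) in
  let lhs := LMeet (LMeet x (LJoin a0 a1)) (LJoin b0 b1) in
  let t bi bj := LMeet (LMeet lhs (LJoin a0 bi)) (LJoin a1 bj) in
  (lhs, LJoin (LJoin (s a0 b0) (s a1 b1)) (LJoin (t b0 b1) (t b1 b0))).

Definition SUB_basis : set lidentity := [set eS; eU; eB]%classic.

Section Basis.
Context {d : Order.disp_t} (L : latticeType d).

Lemma satisfies_S : satisfies L eS <-> identity_S L.
Proof.
split=> [H a b b0 b1 c|H v]; last exact: H.
exact: (H (nth c [:: a; b; b0; b1; c])).
Qed.

Lemma satisfies_U : satisfies L eU <-> identity_U L.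
Proof.
split=> [H x x0 x1 x2|H v]; last exact: H.
exact: (H (nth x [:: x; x0; x1; x2])).
Qed.

Lemma satisfies_B : satisfies L eB <-> identity_B L.
Proof.
split=> [H x a0 a1 b0 b1|H v]; last exact: H.
exact: (H (nth x [:: x; a0; a1; b0; b1])).
Qed.

Lemma SUB_basisP : SUB L <-> forall e, SUB_basis e -> satisfies L e.
Proof.
split=> [[LS LU LB] e [[->|->]|->]|H].
- exact/satisfies_S.
- exact/satisfies_U.
- exact/satisfies_B.
split.
- by apply/satisfies_S/H; left; left.
- by apply/satisfies_U/H; left; right.
- by apply/satisfies_B/H; right.
Qed.

End Basis.

(** * Identities of lattices of order-convex sets *)

Section CoIdentities.
Context {d : Order.disp_t} (P : porderType d).
Implicit Types (X Y Z : Co P) (x y z : P).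

Definition has_below X x := exists2 y, co_set X y & y <= x.
Definition has_above X x := exists2 y, co_set X y & x <= y.

(** Convexity splits membership into two one-sided conditions; with [co_joinE] this reduces (U) and
    (B) to propositional reasoning. *)
Lemma co_inE X x : co_set X x <-> has_below X x /\ has_above X x.
Proof.
split=> [Xx|[[y Xy yx] [z Xz xz]]]; first by split; exists x.
exact: (co_convex Xy Xz).
Qed.

Lemma co_joinE X Y x : co_set (X `|` Y) x <->
  (has_below X x \/ has_below Y x) /\ (has_above X x \/ has_above Y x).
Proof.
split=> [[y [z [[]Hy []Hz yx xz]]]|[]].
- by split; left; [exists y | exists z].
- by split; [left; exists y | right; exists z].
- by split; [right; exists y | left; exists z].
- by split; right; [exists y | exists z].
by case=> -[y Hy yx] [] [z Hz xz]; exists y, z; split=> //; by [left | right].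
Qed.

Lemma co_meetE X Y x : co_set (X `&` Y) x <-> co_set X x /\ co_set Y x.
Proof. by []. Qed.

Lemma le_CoP X Y : (forall x, co_set X x -> co_set Y x) <-> X <= Y.
Proof. by rewrite le_CoE; split=> [|/asboolP]; [move/asboolP|]. Qed.

Lemma co_joinl X Y x : co_set X x -> co_set (X `|` Y) x.
Proof. by move: x; apply/le_CoP/leUl. Qed.

Lemma co_joinr X Y x : co_set Y x -> co_set (X `|` Y) x.
Proof. by move: x; apply/le_CoP/leUr. Qed.

Lemma Co_identity_S : identity_S (Co P).
Proof.
move=> a b b0 b1 c b' t; apply/le_anti/andP; split; last first.
  have tle bi : t bi <= a `&` (b' `|` c) by rewrite leI2 ?leIl ?leU2 ?leIl.
  by rewrite !leUx !tle leI2 ?leUl.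
apply/le_CoP => x [ax b'cx].
have [b'x|nb'x] := pselect (co_set b' x); first exact/co_joinl.
apply: co_joinr.
(* A point of [bi] beyond [y] puts [x] between [bi] and [c], and puts [y] between that point and the
   point [x] of [a]. *)
have between bi y : co_set b' y ->
    (has_below bi y /\ has_above c x /\ y <= x) \/
    (has_above bi y /\ has_below c x /\ x <= y) -> co_set (t bi) x.
  move=> b'y H; split; first split=> //; apply/co_joinE.
  - case: H => -[[z bz zy] [cx yx]]; split; try by right.
    + by left; exists z => //; exact: le_trans yx.
    + by left; exists z => //; exact: le_trans zy.
  - have ly : co_set (b' `&` (a `|` bi)) y.
      split=> //; apply/co_joinE.
      case: H => -[bz [cx yx]]; first by split; [right | left; exists x].
      by split; [left; exists x | right].
    case: H => -[bz [cx yx]]; first by split; [left; exists y | right].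
    by split; [right | left; exists y].
have in_t bi bj : co_set c x -> co_set (t bi `|` t bj) x.
  by move=> cx; apply: co_joinl; split; first split=> //; apply: co_joinr.
case/co_joinE: b'cx => -[[y b'y yx]|cx] [[z b'z xz]|cx'].
- by case: nb'x; apply: (co_convex b'y b'z).
- have [_ /co_joinE[[lo|lo] _]] := b'y.
    by apply/co_joinl/(between _ y) => //; left.
  by apply/co_joinr/(between _ y) => //; left.
- have [_ /co_joinE[_ [up|up]]] := b'z.
    by apply/co_joinl/(between _ z) => //; right.
  by apply/co_joinr/(between _ z) => //; right.
- by apply: in_t; apply/co_inE.
Qed.

Lemma Co_identity_U : identity_U (Co P).
Proof.
move=> x x0 x1 x2; apply/le_anti/andP; split; last first.
  lattice_le.
apply/le_CoP => z; rewrite !co_meetE => -[[[xz h01] h12] h02].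
have [x0z|n0] := pselect (co_set x0 z); first exact/co_joinl/co_joinl.
have [x1z|n1] := pselect (co_set x1 z); first exact/co_joinl/co_joinr.
have [x2z|n2] := pselect (co_set x2 z); first exact/co_joinr.
(* Outside all three sets, each has points on at most one side of [z]; two of them miss the same
   side, so their join misses [z]. *)
move: n0 n1 n2 h01 h12 h02; rewrite !co_joinE !co_inE; tauto.
Qed.

Lemma Co_identity_B : identity_B (Co P).
Proof.
move=> x a0 a1 b0 b1 s t; apply/le_anti/andP; split; last first.
  rewrite /s /t; lattice_le.
apply/le_CoP => z; rewrite !co_meetE => -[[xz ha] hb].
have [a0z|na0] := pselect (co_set a0 z); first exact/co_joinl/co_joinl/co_joinl.
have [b0z|nb0] := pselect (co_set b0 z); first exact/co_joinl/co_joinl/co_joinr.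
have [a1z|na1] := pselect (co_set a1 z); first exact/co_joinl/co_joinr/co_joinl.
have [b1z|nb1] := pselect (co_set b1 z); first exact/co_joinl/co_joinr/co_joinr.
apply: co_joinr.
(* Each of the four sets reaches at most one side of [z]; pair [a0] with the [bj] reaching the other
   side. *)
have [[h1 h2]|[h1 h2]] :
    co_set (a0 `|` b0) z /\ co_set (a1 `|` b1) z \/
    co_set (a0 `|` b1) z /\ co_set (a1 `|` b0) z.
- move: na0 nb0 na1 nb1 ha hb; rewrite !co_joinE !co_inE; tauto.
- exact/co_joinl.
- exact/co_joinr.
Qed.

Lemma Co_SUB : SUB (Co P).
Proof.
by split; [exact: Co_identity_S | exact: Co_identity_U | exact: Co_identity_B].
Qed.

End CoIdentities.

(** * Covers of join-irreducible elements *)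

(** Bounding [x] and [y] by [p] makes this weaker than join-primeness; a least element satisfies
    it. *)
Definition join_irreducible {d} {M : latticeType d} (p : M) : Prop :=
  forall x y : M, p <= x `|` y -> x <= p -> y <= p -> p <= x \/ p <= y.

Section JoinIrreducibles.
Context {d : Order.disp_t} (M : latticeType d) (MSUB : SUB M).
Implicit Types p x y c u : M.

(** Apply (S) with [a := p]: its right side is a join of elements below [p], so irreducibility
    selects one of them, and [~~ (p <= b)] excludes the first. *)
Lemma ji_S p b b0 b1 c : join_irreducible p ->
    p <= b `|` c -> b <= b0 `|` b1 -> ~~ (p <= b) ->
  (p <= b0 `|` c /\ p <= (b `&` (p `|` b0)) `|` c) \/
  (p <= b1 `|` c /\ p <= (b `&` (p `|` b1)) `|` c).
Proof.
move=> pJ pbc /meet_idPl bE npb; have [/(_ p b b0 b1 c) S _ _] := MSUB.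
move: S; rewrite /= bE => S.
have : p <= p `&` (b `|` c) by rewrite lexI lexx.
rewrite S => /pJ[||pb|].
- by rewrite leIl.
- by rewrite leUx -!meetA !leIl.
- by rewrite (le_trans pb (leIr _ _)) in npb.
move=> /pJ[||p_le|p_le]; rewrite -?meetA ?leIl //; [left|right].
  by move: p_le; rewrite !lexI => /andP[/andP[_ ->] ->].
by move: p_le; rewrite !lexI => /andP[/andP[_ ->] ->].
Qed.

(** View the covers of [p] by two elements not above [p] as edges of a graph: (U) forbids
    triangles. *)
Lemma ji_U p x0 x1 x2 : join_irreducible p ->
    p <= x0 `|` x1 -> p <= x1 `|` x2 -> p <= x0 `|` x2 ->
  [\/ p <= x0, p <= x1 | p <= x2].
Proof.
move=> pJ p01 p12 p02; have [_ /(_ p x0 x1 x2) U _] := MSUB.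
have : p <= p `&` (x0 `|` x1) `&` (x1 `|` x2) `&` (x0 `|` x2).
  by rewrite !lexI lexx p01 p12.
rewrite U => /pJ[||/pJ[||H|H]|H];
  rewrite ?leUx -?meetA ?leIl //; move: H;
  rewrite -!meetA !lexI => /and3P[_ H _];
  by [constructor 1 | constructor 2 | constructor 3].
Qed.

(** In the same graph, (B) closes two edges to a possibly degenerate 4-cycle. *)
Lemma ji_B p a0 a1 b0 b1 : join_irreducible p ->
    p <= a0 `|` a1 -> p <= b0 `|` b1 ->
    ~~ (p <= a0) -> ~~ (p <= a1) -> ~~ (p <= b0) -> ~~ (p <= b1) ->
  (p <= a0 `|` b0 /\ p <= a1 `|` b1) \/ (p <= a0 `|` b1 /\ p <= a1 `|` b0).
Proof.
move=> pJ pa pb na0 na1 nb0 nb1; have [_ _ /(_ p a0 a1 b0 b1) B] := MSUB.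
have : p <= p `&` (a0 `|` a1) `&` (b0 `|` b1) by rewrite !lexI lexx pa.
have nle x y : ~~ (p <= x) -> ~ p <= p `&` x `&` y.
  by move=> /negP npx; rewrite !lexI => /andP[/andP[]].
rewrite B => /pJ[||/pJ[||/pJ[||/nle|/nle]|/pJ[||/nle|/nle]]|/pJ[||H|H]];
  rewrite ?leUx -?meetA ?leIl //; move: H;
  rewrite -!meetA !lexI => /and5P[_ _ _ H1 H2];
  by [left | right].
Qed.

End JoinIrreducibles.

Section MinimalCovers.
Context {d : Order.disp_t} (M : latticeType d) (MSUB : SUB M).
Implicit Types p x y z c u v : M.

(** Minimality ranges over all partners [y], not over one fixed partner as in [has_minimal_covers];
    [min_cover_exists] bridges the two. *)
Definition min_cover p c : Prop :=
  ~~ (p <= c) /\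
  forall c' y, ~~ (p <= y) -> p <= c' `|` y -> c' <= c -> c <= c'.

(* [u] orients the nontrivial covers [p <= x `|` y] of [p]: exactly one of [x],
   [y] lies on the side opposite to [u]. *)
Definition oriented p u : Prop :=
  [/\ join_irreducible p, ~~ (p <= u) &
      forall x y, p <= x `|` y ->
        [\/ p <= x, p <= y, p <= x `|` u | p <= y `|` u]].

(** By [ji_S], the meet of [c] with the join of [p] and one of [x], [y] still covers [p] together
    with [u]; minimality puts [c] below that join. *)
Lemma min_cover_S p c u x y : join_irreducible p -> min_cover p c ->
    ~~ (p <= u) -> p <= c `|` u -> c <= x `|` y ->
  (p <= x `|` u /\ c <= p `|` x) \/ (p <= y `|` u /\ c <= p `|` y).
Proof.
move=> pJ [npc cmin] npu pcu cxy.
have [[pu p_le]|[pu p_le]] := ji_S MSUB pJ pcu cxy npc; [left|right];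
  by split=> //; have := cmin _ _ npu p_le (leIl _ _); rewrite lexI => /andP[].
Qed.

Lemma min_cover_ji p c u : join_irreducible p -> min_cover p c ->
  ~~ (p <= u) -> p <= c `|` u -> join_irreducible c.
Proof.
move=> pJ cmin npu pcu x y cxy xc yc.
have [[pxu _]|[pyu _]] := min_cover_S pJ cmin npu pcu cxy; [left|right].
  exact: cmin.2 pxu xc.
exact: cmin.2 pyu yc.
Qed.

Lemma min_cover_oriented p c u : join_irreducible p -> min_cover p c ->
  ~~ (p <= u) -> p <= c `|` u -> oriented c u.
Proof.
move=> pJ cmin npu pcu; split; first exact: min_cover_ji pcu.
  by apply: contra npu => cu; rewrite (le_trans pcu) // leUx cu lexx.
move=> x y cxy.
have [[pxu cpx]|[pyu cpy]] := min_cover_S pJ cmin npu pcu cxy.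
  by constructor 3; rewrite (le_trans cpx) // leUx pxu leUl.
by constructor 4; rewrite (le_trans cpy) // leUx pyu leUl.
Qed.

(** Partner [u] first puts [c] below the join of [p] and [c2]. With a partner [y] not above [p],
    either [c2] and [y] cover [p], which suffices, or [u] and [y] do, closing a triangle with
    [c]. *)
Lemma min_cover_step p c u c2 y : join_irreducible p -> min_cover p c ->
    ~~ (p <= u) -> p <= c `|` u -> c <= c2 `|` u ->
  p <= c `|` y -> c <= c2 `|` y.
Proof.
move=> pJ cmin npu pcu c2u pcy.
have via_p q : c <= p `|` q -> p <= q `|` y -> c <= q `|` y.
  by move=> cpq pqy; rewrite (le_trans cpq) // leUx pqy leUl.
have npuu : ~~ (p <= u `|` u) by rewrite joinxx.
have c2p : c <= p `|` c2.
  have [[]//|[puu _]] := min_cover_S pJ cmin npu pcu c2u.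
  by rewrite puu in npuu.
have [py|npy] := boolP (p <= y).
  by rewrite via_p // (le_trans py) // leUr.
have [[pc2y _]|[puy _]] := min_cover_S pJ cmin npy pcy c2u.
  exact: via_p.
have [pc|pu|py] : [\/ p <= c, p <= u | p <= y] by apply: (ji_U MSUB).
- by case: cmin; rewrite pc.
- by rewrite pu in npu.
- by rewrite py in npy.
Qed.

(** The other outcome of [ji_B] would make [u], [c'] and [u'] a triangle. *)
Lemma min_cover_siblings p u c c' u' : oriented p u ->
    ~~ (p <= c) -> p <= c `|` u ->
    ~~ (p <= c') -> ~~ (p <= u') -> p <= c' `|` u' -> p <= u `|` u' ->
  p <= c `|` c'.
Proof.
move=> [pJ npu _] npc pcu npc' npu' pcu' puu'.
have [[]//|[_ puc']] := ji_B MSUB pJ pcu pcu' npc npu npc' npu'.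
have : [\/ p <= c', p <= u' | p <= u].
  by apply: (ji_U MSUB) => //; rewrite joinC.
by case=> H; [move: npc' | move: npu' | move: npu]; rewrite H.
Qed.

(** An end [u] of a nontrivial cover orients [p] by [ji_B]; without such covers [x] does so
    vacuously. *)
Lemma oriented_exists p x : join_irreducible p -> ~~ (p <= x) ->
  exists u, oriented p u.
Proof.
move=> pJ npx.
have [[u [v [npu npv puv]]]|ncov] :=
  pselect (exists u v, [/\ ~~ (p <= u), ~~ (p <= v) & p <= u `|` v]).
  exists u; split=> // y z pyz.
  have [py|npy] := boolP (p <= y); first by constructor 1.
  have [pz|npz] := boolP (p <= z); first by constructor 2.
  have [[puy _]|[puz _]] := ji_B MSUB pJ puv pyz npu npv npy npz.
    by constructor 3; rewrite joinC.
  by constructor 4; rewrite joinC.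
exists x; split=> // y z pyz.
have [py|npy] := boolP (p <= y); first by constructor 1.
have [pz|npz] := boolP (p <= z); first by constructor 2.
by case: ncov; exists y, z.
Qed.

Definition has_minimal_covers : Prop := forall p x y, p <= x `|` y ->
  exists c, [/\ c <= x, p <= c `|` y &
                forall c', c' <= c -> p <= c' `|` y -> c <= c'].

(** Minimality against the single partner [y] is enough: by [ji_B], any [c'] below [c] with a
    partner [y'] also has partner [y], since [c'] and [c] join to [c] only. *)
Lemma min_cover_exists p x y : has_minimal_covers -> join_irreducible p ->
    ~~ (p <= x) -> ~~ (p <= y) -> p <= x `|` y ->
  exists c, [/\ c <= x, p <= c `|` y & min_cover p c].
Proof.
move=> minM pJ npx npy /minM[c [cx pcy cmin]]; exists c; split=> //.
have npc : ~~ (p <= c) by apply: contra npx => /le_trans; apply.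
split=> // c' y' npy' pc'y' c'c; apply: cmin => //.
have npc' : ~~ (p <= c') by apply: contra npc => /le_trans; apply.
have [[pc'c _]|[]//] := ji_B MSUB pJ pc'y' pcy npc' npy' npc npy.
by move: pc'c; rewrite (join_idPr c'c) (negPf npc).
Qed.

End MinimalCovers.

(** * The tree of minimal covers *)

Lemma cat_eqP {T} (s1 s2 t1 t2 : seq T) : s1 ++ t1 = s2 ++ t2 ->
  (exists v, t2 = v ++ t1 /\ s1 = s2 ++ v) \/
  (exists v, t1 = v ++ t2 /\ s2 = s1 ++ v).
Proof.
elim: s1 s2 => [|x s1 IH] [|y s2] /=.
- by move=> ->; left; exists [::].
- by move=> ->; right; exists (y :: s2).
- by move=> <-; left; exists (x :: s1).
- case=> <- /IH[[v [-> ->]]|[v [-> ->]]]; [left|right]; by exists v.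
Qed.

Section Tree.
Context {d : Order.disp_t} (M : latticeType d).

(* A state [(up, p, u)]: the node sits above its parent iff [up]; it carries the
   join-irreducible [p], whose children [c] with [p <= c `|` u] continue in
   direction [up]. *)
Definition state : Type := (bool * M * M)%type.
Definition goes_up (s : state) : bool := s.1.1.
Definition label (s : state) : M := s.1.2.
Definition opposite (s : state) : M := s.2.

(* A child turning away from the direction of [s] is on the same side as
   [opposite s], that is, [opposite c] covers [label s] with both of them. *)
Definition child (s c : state) : Prop :=
  [/\ min_cover (label s) (label c), ~~ (label s <= opposite c),
      label s <= label c `|` opposite c &
      if goes_up c == goes_up s then opposite c = opposite s
      else label s <= opposite s `|` opposite c].

(* Paths are written from the current node down to the root. *)
Fixpoint valid_path (l : seq state) : Prop :=
  if l is s :: l' then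
    if l' is s' :: _ then child s' s /\ valid_path l'
    else oriented (label s) (opposite s)
  else False.

Record node : Type := Node {
  path_of :> seq state;
  path_ofP : `[< valid_path path_of >] }.

HB.instance Definition _ := [isSub for path_of].
HB.instance Definition _ := [Choice of node by <:].

Lemma node_valid (r : node) : valid_path r.
Proof. exact/asboolP/path_ofP. Qed.

Definition heading (up : bool) : pred state := [pred s | goes_up s == up].

Lemma all_heading_nil up t : all (heading up) t -> all (heading (~~ up)) t ->
  t = [::].
Proof. case: t => // s t /andP[/eqP<- _] /andP[/eqP H _].
by case: (goes_up s) H. Qed.

(** [m] is the path of a common ancestor, from which [r] is reached by downward turns only and [s]
    by upward turns only. It is nonempty, so nodes with distinct roots are incomparable. *)
Definition branch_le (r s : seq state) : Prop := exists m t t' : seq state,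
  [/\ m <> [::], r = t ++ m, s = t' ++ m,
      all (heading false) t & all (heading true) t'].

(** Here [s] lies on the way from the branching point [m] to [q], and [r] leaves [m] in the other
    direction; the flag covers both orientations. *)
Definition fork (up : bool) (r s q : seq state) : Prop :=
  exists m t v w : seq state,
    [/\ m <> [::], r = t ++ m, s = v ++ m & q = w ++ v ++ m] /\
    (all (heading up) t /\ all (heading (~~ up)) (w ++ v)).

(* The branching points of [r <= s] and of [s <= q] are suffixes of [s], hence
   comparable. *)
Lemma branch_le_fork r s q : branch_le r s -> branch_le s q ->
  fork false r s q \/ fork true q s r.
Proof.
move=> [m [t [t' [m0 -> -> td t'u]]]] [n [u [u' [n0 seq_ -> ud u'u]]]].
case: (cat_eqP seq_) => -[v [E1 E2]]; subst.
  move: t'u; rewrite all_cat => /andP[uu vu].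
  have -> : u = [::] by exact: all_heading_nil uu ud.
  by left; exists m, t, v, u'; rewrite all_cat u'u vu.
move: ud; rewrite all_cat => /andP[t'd vd].
have -> : t' = [::] by exact: all_heading_nil t'u t'd.
by right; exists n, u', v, t; rewrite all_cat td vd.
Qed.

Lemma branch_le_refl r : r <> [::] -> branch_le r r.
Proof. by move=> r0; exists r, [::], [::]. Qed.

Lemma branch_le_trans s r q : branch_le r s -> branch_le s q -> branch_le r q.
Proof.
move=> rs /(branch_le_fork rs)[] [m [t [v [w [[m0 -> _ ->] [tP wvP]]]]]].
  by exists m, t, (w ++ v); rewrite catA.
by exists m, (w ++ v), t; rewrite catA.
Qed.

Lemma branch_le_anti r s : branch_le r s -> branch_le s r -> r = s.
Proof.
have fork_id up q q' : fork up q q' q -> q = q'.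
  move=> [m [t [v [w [[m0 -> -> E] [tP wvP]]]]]].
  have tE : t = w ++ v.
    have sz : size t = size (w ++ v).
      by move/(congr1 size): E; rewrite catA !(size_cat _ m) => /addIn.
    by move/eqP: E; rewrite catA eqseq_cat // => /andP[/eqP].
  have : w ++ v = [::] by apply: all_heading_nil wvP; rewrite -tE.
  by rewrite tE; case: w {E tE wvP} => // ->.
by move=> rs /(branch_le_fork rs)[/fork_id|/fork_id].
Qed.

Definition node_le (r s : node) : bool := `[< branch_le r s >].

Lemma node_le_refl : reflexive node_le.
Proof.
move=> r; apply/asboolP/branch_le_refl => r0.
by have := node_valid r; rewrite r0.
Qed.

Lemma node_le_anti : antisymmetric node_le.
Proof.
by move=> r s /andP[/asboolP rs /asboolP sr]; apply/val_inj/branch_le_anti.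
Qed.

Lemma node_le_trans : transitive node_le.
Proof.
by move=> s r q /asboolP rs /asboolP sq; apply/asboolP/(branch_le_trans rs).
Qed.

HB.instance Definition _ :=
  Order.Le_isPOrder.Build d node node_le_refl node_le_anti node_le_trans.

Lemma node_leP (r s : node) : reflect (branch_le r s) (r <= s).
Proof. exact: asboolP. Qed.

End Tree.

(** * Labels along monotone branches of the tree *)

Section TreeRepresentation.
Context {d : Order.disp_t} (M : latticeType d) (MSUB : SUB M).
Implicit Types (s c : state M) (l m t v w : seq (state M)) (x y z : M).

Lemma valid_path_cat t s m : valid_path (t ++ s :: m) -> valid_path (s :: m).
Proof.
by elim: t => // s' [|s'' t] IH /=; [case | case=> _].
Qed.

Lemma child_oriented s c :
    oriented (label s) (opposite s) -> child s c ->
  oriented (label c) (opposite c).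
Proof. by move=> [pJ _ _] [cmin npu pcu _]; apply: min_cover_oriented pcu. Qed.

Lemma valid_path_oriented s m :
  valid_path (s :: m) -> oriented (label s) (opposite s).
Proof.
by elim: m s => // p m IH s [ps /IH/child_oriented]; apply.
Qed.

Definition head_le l x : bool := if l is s :: _ then label s <= x else true.

(** Equal directions give [c2] and [c] the same opposite element, which is the [u] of
    [min_cover_step]. *)
Lemma chain_step c2 c p m y : valid_path (c2 :: c :: p :: m) ->
    goes_up c2 = goes_up c ->
  label p <= label c `|` y -> label c <= label c2 `|` y.
Proof.
move=> [[_ _ c2u]] + [[cmin npu pcu _]] /valid_path_oriented[pJ _ _] E.
rewrite E eqxx => uE; rewrite uE in c2u.
exact: (min_cover_step MSUB pJ cmin npu pcu c2u).
Qed.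

(** [chain_step] carries the partner [y] out to the head, whose label is below [z]; the bound then
    returns inward, each label lying below the join of the next one with [y]. *)
Lemma chain_le_top up w c p m y z : valid_path (w ++ c :: p :: m) ->
    all (heading up) (rcons w c) -> label p <= label c `|` y ->
    head_le (w ++ c :: p :: m) z ->
  label c <= z `|` y /\ label p <= z `|` y.
Proof.
elim/last_ind: w c p m => [|w c2 IH] c p m.
  move=> _ _ pcy /= cz; have czy : label c <= z `|` y by rewrite lexUl.
  by split=> //; rewrite (le_trans pcy) // leUx czy leUr.
rewrite cat_rcons => wV wU pcy wz.
have c2V := valid_path_cat wV.
have wU2 : all (heading up) (rcons w c2).
  by move: wU; rewrite all_rcons => /andP[].
have E : goes_up c2 = goes_up c.
  by move: wU; rewrite !all_rcons => /and3P[/eqP-> /eqP->].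
have c2y := chain_step c2V E pcy.
have [_ czy] := IH _ _ _ wV wU2 c2y wz.
by split=> //; rewrite (le_trans pcy) // leUx czy leUr.
Qed.

Lemma chain_le_mid up w v c p m y z : valid_path (w ++ v ++ c :: p :: m) ->
    all (heading up) (w ++ rcons v c) -> label p <= label c `|` y ->
    head_le (w ++ v ++ c :: p :: m) z ->
  head_le (v ++ c :: p :: m) (z `|` y).
Proof.
elim/last_ind: v c p m => [|v c2 IH] c p m /=.
  by rewrite cats1 => wV wU pcy wz; have [] := chain_le_top wV wU pcy wz.
rewrite cat_rcons => wV wU pcy wz.
have c2V := valid_path_cat (t := w ++ v).
have {}c2V : valid_path (c2 :: c :: p :: m) by apply: c2V; rewrite -catA.
have wU2 : all (heading up) (w ++ rcons v c2).
  by move: wU; rewrite -!rcons_cat all_rcons => /andP[].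
have E : goes_up c2 = goes_up c.
  by move: wU; rewrite -!rcons_cat !all_rcons => /and3P[/eqP-> /eqP->].
exact: IH wV wU2 (chain_step c2V E pcy) wz.
Qed.

(** One of the children keeps the direction of [p], hence its opposite element; the last clause of
    [child] relates this to the other child, as [min_cover_siblings] requires. *)
Lemma siblings_le p c c' : oriented (label p) (opposite p) -> child p c ->
  child p c' -> goes_up c != goes_up c' -> label p <= label c `|` label c'.
Proof.
wlog cp : c c' / goes_up c = goes_up p.
  move=> H pO pc pc' cc'.
  have [cp|c'p] : goes_up c = goes_up p \/ goes_up c' = goes_up p.
    by case: (goes_up c) (goes_up c') (goes_up p) cc' => [] [] [] //; auto.
  - exact: H.
  - by rewrite joinC; apply: H => //; rewrite eq_sym.
rewrite cp => pO [[npc _] _ pcu +] [[npc' _] npu' pcu' +] /negPf cc'.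
rewrite cp eqxx eq_sym cc' => uE puu'; rewrite uE in pcu.
exact: (min_cover_siblings MSUB pO npc pcu npc' npu' pcu' puu').
Qed.

Lemma fork_convex up (r l q : seq (state M)) x :
    fork up r l q -> valid_path r -> valid_path q ->
  head_le r x -> head_le q x -> head_le l x.
Proof.
move=> [[|p m] [t [v [w [[//= _ -> -> ->] [tU wvU]]]]]] rV qV rx qx.
have pO : oriented (label p) (opposite p).
  exact/valid_path_oriented/(valid_path_cat rV).
(* Either [r] stops at [p], so the label of [p] is below [x], or it leaves [p] through a child [c']
   turning away from [c]; then the cover of [p] by these siblings is carried along [t] to [r]. *)
have pcx c : child p c -> goes_up c = ~~ up -> label p <= label c `|` x.
  move=> pc cU.
  elim/last_ind: t rV tU rx {qx} => [|t c' _] /= rV tU rx.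
    by rewrite (le_trans rx) ?leUr.
  rewrite cat_rcons in rV rx.
  have [pc' _] := valid_path_cat rV.
  have c'U : goes_up c' = up by move: tU; rewrite all_rcons => /andP[/eqP].
  have pcc' : label p <= label c' `|` label c.
    by apply: siblings_le => //; rewrite cU c'U; case: (up).
  by have [_] := chain_le_top rV tU pcc' rx; rewrite joinC.
case/lastP: v wvU qV qx => [|v c].
  rewrite /= cats0; case/lastP: w => [|w c] //= wU.
  rewrite cat_rcons => qV qx; have [pc _] := valid_path_cat qV.
  have cU : goes_up c = ~~ up by move: wU; rewrite all_rcons => /andP[/eqP].
  by have [_] := chain_le_top qV wU (pcx c pc cU) qx; rewrite joinxx.
rewrite cat_rcons => wvU qV qx.
have [pc _] : valid_path (c :: p :: m).
  by apply: (valid_path_cat (t := w ++ v)); rewrite -catA.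
have cU : goes_up c = ~~ up.
  by move: wvU; rewrite -rcons_cat all_rcons => /andP[/eqP].
by have := chain_le_mid qV wvU (pcx c pc cU) qx; rewrite joinxx.
Qed.

End TreeRepresentation.

(** * The morphism into order-convex sets of nodes *)

Section TreeEmbedding.
Context {d : Order.disp_t} (M : latticeType d) (MSUB : SUB M).
Context (minM : has_minimal_covers M).
Implicit Types (x y : M) (r s q : node M).

Lemma labelled_below_convex x :
  `[< order_convex [set r : node M | head_le r x]%classic >].
Proof.
apply/asboolP => r q s rx qx /node_leP rs /node_leP sq.
have [rV qV] := (node_valid r, node_valid q).
case: (branch_le_fork rs sq) => H.
  exact: (fork_convex MSUB H rV qV rx qx).
exact: (fork_convex MSUB H qV rV qx rx).
Qed.

Definition labelled_below x : Co (node M) := MkCo (labelled_below_convex x).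

Lemma labelled_belowI : {morph labelled_below : x y / x `&` y}.
Proof.
move=> x y; apply/val_inj/seteqP => /=.
by split=> -[[|s l] V] //=; rewrite lexI; [move/andP | move=> [/= -> ->]].
Qed.

Lemma branch_le_up (c s : state M) l :
  goes_up c -> branch_le (s :: l) (c :: s :: l).
Proof.
move=> cU; exists (s :: l), [::], [:: c]; split=> //.
by rewrite all_seq1; apply/eqP.
Qed.

Lemma branch_le_down (c s : state M) l :
  ~~ goes_up c -> branch_le (c :: s :: l) (s :: l).
Proof.
move=> cD; exists (s :: l), [:: c], [::]; split=> //.
by rewrite all_seq1; apply/eqP/negbTE.
Qed.

Lemma cover_children (s : state M) l x y : valid_path (s :: l) ->
    ~~ (label s <= x) -> ~~ (label s <= y) -> label s <= x `|` y ->
    label s <= x `|` opposite s ->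
  exists c c' : state M, [/\ label c <= x, label c' <= y,
    goes_up c' = ~~ goes_up c, valid_path (c :: s :: l) &
    valid_path (c' :: s :: l)].
Proof.
move=> sV nx ny sxy sxu; have [sJ nu _] := valid_path_oriented MSUB sV.
have [c [cx scu cmin]] := min_cover_exists MSUB minM sJ nx nu sxu.
have syx : label s <= y `|` x by rewrite joinC.
have [c' [c'y sc'x c'min]] := min_cover_exists MSUB minM sJ ny nx syx.
(* The first child keeps the direction and opposite element of [s]; the second turns away with [x]
   as opposite element, which [sxu] permits. *)
exists (goes_up s, c, opposite s), (~~ goes_up s, c', x); split=> //.
  by split=> //; split=> //=; rewrite eqxx.
split=> //; split=> //=; rewrite /goes_up /=.
by case: (s.1.1); rewrite /= joinC.
Qed.

Lemma labelled_below_join (s : state M) l x y (V : `[< valid_path (s :: l) >]) :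
    ~~ (label s <= x) -> ~~ (label s <= y) -> label s <= x `|` y ->
    label s <= x `|` opposite s ->
  co_set (labelled_below x `|` labelled_below y) (Node V).
Proof.
move=> nx ny sxy sxu.
have [c [c' [cx c'y cc' cV c'V]]] :=
  cover_children (elimT (asboolP _) V) nx ny sxy sxu.
pose r := Node (introT (asboolP _) cV).
pose r' := Node (introT (asboolP _) c'V).
have [cU|cD] := boolP (goes_up c).
  exists r', r; split; [by right | by left | |]; apply/node_leP.
    by apply: branch_le_down; rewrite cc' negbK.
  exact: branch_le_up.
exists r, r'; split; [by left | by right | |]; apply/node_leP.
  exact: branch_le_down.
by apply: branch_le_up; rewrite cc'.
Qed.

Lemma labelled_belowU : {morph labelled_below : x y / x `|` y}.
Proof.
move=> x y; apply/le_anti/andP; split; last first.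
  rewrite leUx; apply/andP; split; apply/le_CoP => -[[|s l] V] //= H.
    by rewrite lexUl.
  by rewrite lexUr.
apply/le_CoP => -[[|s l] V] sxy; first by have := node_valid (Node V).
have [sx|nx] := boolP (label s <= x); first exact: co_joinl.
have [sy|ny] := boolP (label s <= y); first exact: co_joinr.
have [_ _ /(_ x y sxy)[]] := valid_path_oriented MSUB (node_valid (Node V)).
- by rewrite (negPf nx).
- by rewrite (negPf ny).
- exact: labelled_below_join.
- by rewrite (joinC (labelled_below x)); apply: labelled_below_join => //;
    rewrite joinC.
Qed.

End TreeEmbedding.

(** * The lattice of filters *)

Section Filters.
Context {d : Order.disp_t} (L : latticeType d).
Local Open Scope classical_set_scope.

Definition is_lfilter (F : set L) : Prop :=
  [/\ F !=set0, forall x y, F x -> x <= y -> F y &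
      forall x y, F x -> F y -> F (x `&` y)%O].

Record lfilter : Type := LFilter {
  lfilter_set :> set L;
  lfilterP : `[< is_lfilter lfilter_set >] }.

HB.instance Definition _ := [isSub for lfilter_set].
HB.instance Definition _ := [Choice of lfilter by <:].
Implicit Types F G H : lfilter.

Lemma lfilter_ex F : exists x, lfilter_set F x.
Proof. by case: (asboolW (lfilterP F)). Qed.

Lemma lfilter_up F x y : lfilter_set F x -> x <= y -> lfilter_set F y.
Proof. by case: (asboolW (lfilterP F)) => _ + _; apply. Qed.

Lemma lfilter_meet F x y :
  lfilter_set F x -> lfilter_set F y -> lfilter_set F (x `&` y)%O.
Proof. by case: (asboolW (lfilterP F)) => _ _; apply. Qed.

(* Reverse inclusion, so that [L] embeds covariantly by principal filters. *)
Definition lfilter_le F G : bool := `[< lfilter_set G `<=` lfilter_set F >].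

Lemma lfilter_le_refl : reflexive lfilter_le.
Proof. by move=> F; apply/asboolP. Qed.

Lemma lfilter_le_anti : antisymmetric lfilter_le.
Proof.
by move=> F G /andP[/asboolP GF /asboolP FG]; apply/val_inj/seteqP.
Qed.

Lemma lfilter_le_trans : transitive lfilter_le.
Proof.
by move=> G F H /asboolP GF /asboolP HG; apply/asboolP/(subset_trans HG).
Qed.

HB.instance Definition _ :=
  Order.Le_isPOrder.Build d lfilter lfilter_le_refl lfilter_le_anti
    lfilter_le_trans.

Lemma le_lfilterP F G : reflect (lfilter_set G `<=` lfilter_set F) (F <= G)%O.
Proof. exact: asboolP. Qed.

Lemma lfilter_join_subproof F G :
  `[< is_lfilter (lfilter_set F `&` lfilter_set G) >].
Proof.
apply/asboolP; split.
- have [[x Fx] [y Gy]] := (lfilter_ex F, lfilter_ex G).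
  exists (x `|` y)%O; split; first exact: lfilter_up Fx (leUl _ _).
  exact: lfilter_up Gy (leUr _ _).
- by move=> x y [Fx Gx] xy; split; exact: lfilter_up xy.
- by move=> x y [Fx Gx] [Fy Gy]; split; exact: lfilter_meet.
Qed.

Lemma lfilter_meet_subproof F G : `[< is_lfilter [set z |
  exists x y, [/\ lfilter_set F x, lfilter_set G y & x `&` y <= z]%O] >].
Proof.
apply/asboolP; split.
- have [[x Fx] [y Gy]] := (lfilter_ex F, lfilter_ex G).
  by exists (x `&` y)%O, x, y.
- move=> z t [x [y [Fx Gy xyz]]] zt; exists x, y; split=> //.
  exact: le_trans zt.
- move=> z t [x [y [Fx Gy xyz]]] [x' [y' [Fx' Gy' xyt]]].
  exists (x `&` x')%O, (y `&` y')%O; split; [exact: lfilter_meet..|].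
  by rewrite meetACA leI2.
Qed.

Definition lfilter_joinf F G : lfilter := LFilter (lfilter_join_subproof F G).
Definition lfilter_meetf F G : lfilter := LFilter (lfilter_meet_subproof F G).

Lemma lfilter_meetP F G H :
  (F <= lfilter_meetf G H)%O = (F <= G)%O && (F <= H)%O.
Proof.
apply/le_lfilterP/andP => [sub|[/le_lfilterP GF /le_lfilterP HF]].
  have [[x Gx] [y Hy]] := (lfilter_ex G, lfilter_ex H).
  split; apply/le_lfilterP => z Fz; apply: sub.
    by exists z, y; rewrite leIl.
  by exists x, z; rewrite leIr.
move=> z [x [y [/GF Fx /HF Fy xyz]]].
exact: lfilter_up (lfilter_meet Fx Fy) xyz.
Qed.

Lemma lfilter_joinP F G H :
  (lfilter_joinf F G <= H)%O = (F <= H)%O && (G <= H)%O.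
Proof.
apply/le_lfilterP/andP => [sub|[/le_lfilterP HF /le_lfilterP HG] z Hz].
  by split; apply/le_lfilterP => z /sub[].
by split; [exact: HF | exact: HG].
Qed.

HB.instance Definition _ :=
  Order.POrder_MeetJoin_isLattice.Build d lfilter lfilter_meetP lfilter_joinP.

Lemma leval_mono (f g : nat -> L) e :
  (forall n, f n <= g n)%O -> (leval f e <= leval g e)%O.
Proof.
by move=> fg; elim: e => //= e1 IH1 e2 IH2; [exact: leI2 | exact: leU2].
Qed.

(** Two selections from the filters merge into their pointwise meet, which lowers every term value
    by monotonicity. This carries identities from [L] to its filters. *)
Lemma leval_lfilterE (v : nat -> lfilter) e z : lfilter_set (leval v e) z <->
  exists f, (forall n, lfilter_set (v n) (f n)) /\ (leval f e <= z)%O.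
Proof.
have meet_sel f g : (forall n, lfilter_set (v n) (f n)) ->
    (forall n, lfilter_set (v n) (g n)) ->
  exists h, [/\ forall n, lfilter_set (v n) (h n),
                forall e', (leval h e' <= leval f e')%O &
                forall e', (leval h e' <= leval g e')%O].
  move=> vf vg; exists (fun n => f n `&` g n)%O; split=> [n|e'|e'].
  - exact: lfilter_meet.
  - by apply: leval_mono => n; rewrite leIl.
  - by apply: leval_mono => n; rewrite leIr.
elim: e z => [n|e1 IH1 e2 IH2|e1 IH1 e2 IH2] z /=.
- split=> [vz|[f [vf fz]]]; last exact: lfilter_up fz.
  have [f vf] := choice (fun m => lfilter_ex (v m)).
  exists (fun m => if m == n then z else f m); rewrite eqxx; split=> // m.
  by case: eqP => [->|].
- split=> [[x [y [/IH1[f [vf fx]] /IH2[g [vg gy]] xyz]]]|[f [vf fz]]].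
    have [h [vh hf hg]] := meet_sel f g vf vg; exists h; split=> //.
    by rewrite (le_trans _ xyz) // leI2 // (le_trans _ fx, le_trans _ gy).
  exists (leval f e1), (leval f e2); split=> //; [apply/IH1|apply/IH2];
    by exists f.
- split=> [[/IH1[f [vf fz]] /IH2[g [vg gz]]]|[f [vf]]].
    have [h [vh hf hg]] := meet_sel f g vf vg; exists h; split=> //.
    by rewrite leUx (le_trans (hf _) fz) (le_trans (hg _) gz).
  rewrite leUx => /andP[f1 f2]; split; [apply/IH1|apply/IH2]; by exists f.
Qed.

Lemma satisfies_lfilter e : satisfies L e -> satisfies lfilter e.
Proof.
move=> Le v; apply/val_inj/seteqP; split=> z /leval_lfilterE[f [vf fz]];
  by apply/leval_lfilterE; exists f; split=> //; move: fz; rewrite Le.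
Qed.

(** Taking filters [p], [y] for [X], [Y] gives minimal covers; taking [X] empty and [Y] a singleton
    gives maximal filters avoiding a point. *)
Lemma lfilter_maximal (F : lfilter) (X Y : set L) :
    lfilter_set F `&` Y `<=` X ->
  exists G : lfilter, [/\ (G <= F)%O, lfilter_set G `&` Y `<=` X &
    forall H : lfilter, (H <= G)%O -> lfilter_set H `&` Y `<=` X -> (G <= H)%O].
Proof.
move=> FYX.
(* Adjoining [F] to [A] handles the empty chain in Zorn's lemma: its union is empty, and [P] then
   speaks of [F]. *)
pose P (A : set L) := is_lfilter (A `|` lfilter_set F) /\
  (A `|` lfilter_set F) `&` Y `<=` X.
have FP : is_lfilter (lfilter_set F) by apply/asboolP/lfilterP.
have [C CP Ctot|A [[Afil AYX] Amax]] := @Zorn_bigcup L P.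
  have common x y :
      (\bigcup_(A in C) A `|` lfilter_set F) x ->
      (\bigcup_(A in C) A `|` lfilter_set F) y ->
    exists K, [/\ is_lfilter K, K x, K y, K `&` Y `<=` X &
                  K `<=` \bigcup_(A in C) A `|` lfilter_set F].
    have inC A : C A ->
        A `|` lfilter_set F `<=` \bigcup_(A in C) A `|` lfilter_set F.
      by move=> CA z [Az|Fz]; [left; exists A | right].
    have ofC A : C A -> (A `|` lfilter_set F) x -> (A `|` lfilter_set F) y ->
        exists K, [/\ is_lfilter K, K x, K y, K `&` Y `<=` X &
                      K `<=` \bigcup_(A in C) A `|` lfilter_set F].
      move=> CA Ax Ay; have [AF AYX] := CP A CA.
      by exists (A `|` lfilter_set F); split=> //; apply: inC.
    move=> [[A CA Ax]|Fx] [[B CB By]|Fy].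
    - by case: (Ctot A B CA CB) => sub; [apply: (ofC B) | apply: (ofC A)] => //;
        left => //; apply: sub.
    - by apply: (ofC A) => //; [left | right].
    - by apply: (ofC B) => //; [right | left].
    - by exists (lfilter_set F); split=> // z Fz; right.
  split; first split.
  - by have [z Fz] := lfilter_ex F; exists z; right.
  - by move=> x y /[dup] Ux /(common _ _ Ux)[K [[_ up _] Kx _ _ sub]] xy;
      apply/sub/up/xy.
  - by move=> x y Ux Uy; have [K [[_ _ meet] Kx Ky _ sub]] := common _ _ Ux Uy;
      apply/sub/meet.
  - move=> z [Uz Yz]; have [K [_ Kz _ KYX _]] := common _ _ Uz Uz.
    exact: KYX.
pose G := LFilter (introT (asboolP _) Afil).
exists G; split=> //; first by apply/le_lfilterP => z Fz; right.
move=> H /le_lfilterP GH HYX; apply/le_lfilterP; apply: contrapT => nHG.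
apply: (Amax (lfilter_set H)).
  split; first by move=> z Az; apply: GH; left.
  by move=> HA; apply: nHG => z /HA; left.
rewrite /P (_ : lfilter_set H `|` lfilter_set F = lfilter_set H).
  by split=> //; apply/asboolP/lfilterP.
by apply/setUidl => z Fz; apply: GH; right.
Qed.

Lemma lfilter_has_minimal_covers : has_minimal_covers lfilter.
Proof.
move=> p x y /le_lfilterP pxy.
have [c [cx pcy cmin]] := lfilter_maximal pxy.
exists c; split=> //; first exact/le_lfilterP.
by move=> c' c'c /le_lfilterP pc'y; apply: cmin.
Qed.

(** Take [p] maximal among filters that contain [F] and avoid [u]. Two larger filters whose
    intersection lies in [p] cannot both contain [u], and one that avoids [u] equals [p]. *)
Lemma lfilter_separation (F : lfilter) u : ~ lfilter_set F u ->
  exists p, [/\ join_irreducible p, (p <= F)%O & ~ lfilter_set p u].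
Proof.
move=> nFu.
have avoid (G : lfilter) :
    lfilter_set G `&` [set u] `<=` set0 <-> ~ lfilter_set G u.
  by split=> [sub Gu|nGu z [Gz zu]]; [apply: (sub u) | apply: nGu; rewrite -zu].
have [p [pF /avoid npu pmax]] := lfilter_maximal ((avoid F).2 nFu).
exists p; split=> // x y /le_lfilterP pxy xp yp.
have [xu|nxu] := pselect (lfilter_set x u).
  right; apply: pmax => //; apply/avoid => yu.
  exact/npu/pxy.
by left; apply: pmax => //; apply/avoid.
Qed.

Lemma principal_subproof (x : L) : `[< is_lfilter [set y | x <= y]%O >].
Proof.
apply/asboolP; split.
- by exists x => /=.
- by move=> y z /= xy yz; exact: le_trans yz.
- by move=> y z /= xy xz; rewrite lexI xy.
Qed.

Definition principal (x : L) : lfilter := LFilter (principal_subproof x).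

Lemma principalI : {morph principal : x y / (x `&` y)%O}.
Proof.
move=> x y; apply/val_inj/seteqP; split=> z /=.
  by move=> xyz; exists x, y.
by move=> [x' [y' [xx' yy' z_ge]]]; apply: le_trans z_ge; rewrite leI2.
Qed.

Lemma principalU : {morph principal : x y / (x `|` y)%O}.
Proof.
move=> x y; apply/val_inj/seteqP; split=> z /=; first by rewrite leUx => /andP.
by move=> [/= xz yz]; rewrite leUx xz.
Qed.

End Filters.

(** * Characterization of the embeddable lattices and closure under quotients *)

Lemma lmorphism_Co_embeddable d d' (L : latticeType d) (P : porderType d')
    (f : L -> Co P) :
    {morph f : x y / x `&` y} -> {morph f : x y / x `|` y} -> injective f ->
  Co_embeddable L.
Proof.
move=> fI fU f_inj.
have fle : {homo f : x y / x <= y}.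
  by move=> x y /meet_idPl xy; apply/meet_idPl; rewrite -fI xy.
pose fo := Order.isOrderMorphism.Build _ _ _ _ f fle.
pose fm := Order.isMeetLatticeMorphism.Build _ _ _ _ f fI.
pose fj := Order.isJoinLatticeMorphism.Build _ _ _ _ f fU.
pose F : {lmorphism L -> Co P} := HB.pack f fo fm fj.
by exists d', P, F.
Qed.

Lemma SUB_Co_embeddable d (L : latticeType d) : SUB L -> Co_embeddable L.
Proof.
move=> LSUB.
have MSUB : SUB (lfilter L).
  apply/SUB_basisP => e /(SUB_basisP L).1-/(_ LSUB).
  exact: satisfies_lfilter.
have minM := @lfilter_has_minimal_covers _ L.
pose f x := labelled_below MSUB (principal x).
have fI : {morph f : x y / x `&` y}.
  by move=> x y; rewrite /f principalI labelled_belowI.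
have fU : {morph f : x y / x `|` y}.
  by move=> x y; rewrite /f principalU (labelled_belowU MSUB minM).
apply: (lmorphism_Co_embeddable fI fU).
suff fle x y : f x <= f y -> x <= y.
  by move=> x y fxy; apply/le_anti; rewrite !fle ?fxy.
move=> fxy; apply: contrapT => nxy.
have [p [pJ px npy]] := lfilter_separation (F := principal x) nxy.
have npy' : ~~ (p <= principal y).
  by apply/negP => /le_lfilterP py; apply/npy/py/lexx.
have [u pu] := oriented_exists MSUB pJ npy'.
(* The root labelled [p] separates [f x] from [f y]; having no parent, it may carry either flag. *)
pose r := Node (introT (asboolP (valid_path [:: (true, p, u)])) pu).
have := (le_CoP (f x) (f y)).2 fxy r px.
by apply/negP.
Qed.

Lemma Co_embeddableP d (L : latticeType d) : Co_embeddable L <-> SUB L.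
Proof.
split=> [[d' [P [f f_inj]]]|]; last exact: SUB_Co_embeddable.
apply/SUB_basisP => e eE; apply: (satisfies_inj f_inj).
by have /SUB_basisP := Co_SUB P; apply.
Qed.

Lemma Co_embeddable_basis : defined_by SUB_basis (@Co_embeddable).
Proof. by move=> d L; rewrite Co_embeddableP SUB_basisP. Qed.

Lemma finite_SUB_basis : finite_set SUB_basis.
Proof. by rewrite !finite_setU; do ?split; exact: finite_set1. Qed.

Theorem corollary6p9 :
  (forall (d : Order.disp_t) (L : latticeType d),
      Co_embeddable L <-> SUB L) /\
  (is_variety (@Co_embeddable) /\ finitely_based (@Co_embeddable)) /\
  closed_under_homomorphic_images (@Co_embeddable).
Proof.
split; first exact: Co_embeddableP.
split; first split.
- by exists SUB_basis; exact: Co_embeddable_basis.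
- by exists SUB_basis; split;
    [exact: finite_SUB_basis | exact: Co_embeddable_basis].
move=> d d' L M f f_surj /Co_embeddable_basis LE.
apply/Co_embeddable_basis => e /LE; exact: satisfies_surj.
Qed.
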